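(* For all integers $n\geq 1$ and $H\geq 0$, the number of nonisomorphic $n$-element unlabeled semiorders of length $H$ is equal to the number of $(n+1)$-node ordered trees of height $H+1$, which is also equal to the number of Dyck paths with semilength $n$ and height $H+1$.
   Context: All posets are finite. A semiorder is a poset with no induced subposet isomorphic to $\mathbf{2}+\mathbf{2}$ (four distinct elements $x,y,z,w$ with $x>y$, $z>w$ and all other pairs incomparable) and none isomorphic to $\mathbf{3}+\mathbf{1}$ (four distinct elements $x,y,z,w$ with $x>y>z$ and $w$ incomparable to each of $x,y,z$). The length of a semiorder is the length of a longest chain, where a chain with $\ell+1$ elements has length $\ell$. Unlabeled semiorders are counted up to isomorphism. An ordered tree is a rooted tree embedded in the plane so that the relative order of the subtrees at each node is part of its structure. Its height is the number of edges in a longest chain, i.e. in a longest path descending from the root. A Dyck path of semilength $n$ is a lattice path from $(0,0)$ to $(2n,0)$ with steps $(1,1)$ and $(1,-1)$ that never goes below the $x$-axis. Its height is the maximal $y$-coordinate among its points. *)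

(* Defs.v *)
From HB Require Import structures.
From mathcomp Require Import all_boot all_order all_algebra all_fingroup.
From mathcomp Require Import classical_sets functions cardinality.

Set Implicit Arguments.
Unset Strict Implicit.
Unset Printing Implicit Defensive.

Import Order.TTheory GRing.Theory Num.Theory.

(* A finite poset on T is given by the set R of all pairs (x, y) with x <= y. *)

Definition ple (T : finType) (R : {set T * T}) (x y : T) : bool := (x, y) \in R.

Definition pgt (T : finType) (R : {set T * T}) (x y : T) : bool :=
  (x != y) && ple R y x.

Definition incomparable (T : finType) (R : {set T * T}) (x y : T) : bool :=
  ~~ ple R x y && ~~ ple R y x.

Definition is_poset (T : finType) (R : {set T * T}) : bool :=
  [&& [forall x, ple R x x],
      [forall x, forall y, ple R x y && ple R y x ==> (x == y)]
    & [forall x, forall y, forall z, ple R x y && ple R y z ==> ple R x z]].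

Definition has_2plus2 (T : finType) (R : {set T * T}) : bool :=
  [exists x, exists y, exists z, exists w,
    [&& uniq [:: x; y; z; w], pgt R x y, pgt R z w,
        incomparable R x z, incomparable R x w,
        incomparable R y z & incomparable R y w]].

Definition has_3plus1 (T : finType) (R : {set T * T}) : bool :=
  [exists x, exists y, exists z, exists w,
    [&& uniq [:: x; y; z; w], pgt R x y, pgt R y z,
        incomparable R w x, incomparable R w y & incomparable R w z]].

Definition is_semiorder (T : finType) (R : {set T * T}) : bool :=
  [&& is_poset R, ~~ has_2plus2 R & ~~ has_3plus1 R].

Definition is_chain (T : finType) (R : {set T * T}) (C : {set T}) : bool :=
  [forall x in C, forall y in C, ple R x y || ple R y x].

Definition poset_length (T : finType) (R : {set T * T}) : nat :=
  \max_(C : {set T} | is_chain R C) #|C|.-1.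

Definition poset_iso (T : finType) (R S : {set T * T}) : bool :=
  [exists s : {perm T}, forall x, forall y, ple S (s x) (s y) == ple R x y].

(* Every n-element poset is isomorphic to one on 'I_n, so the n-element
   unlabeled semiorders of length H are the isomorphism classes below. *)
Definition unlabeled_semiorders (n H : nat) : {set {set {set 'I_n * 'I_n}}} :=
  equivalence_partition (@poset_iso 'I_n)
    [set R | is_semiorder R & poset_length R == H].

Inductive otree : Type := ONode of seq otree.

Fixpoint tree_nodes (t : otree) : nat :=
  let: ONode s := t in (sumn [seq tree_nodes u | u <- s]).+1.

Fixpoint tree_height (t : otree) : nat :=
  let: ONode s := t in foldr maxn 0 [seq (tree_height u).+1 | u <- s].

Definition ordered_trees (m h : nat) : set otree :=
  [set t | tree_nodes t = m /\ tree_height t = h]%classic.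

(* A path is the sequence of its steps: true is (1, 1), false is (1, -1).
   After i steps it is at the point (i, path_y p i). *)
Definition path_y (p : seq bool) (i : nat) : int :=
  (\sum_(b <- take i p) (if b then 1 else -1))%R.

Definition is_dyck (n : nat) (p : (2 * n).-tuple bool) : bool :=
  (path_y p (2 * n) == 0)%R && [forall i : 'I_(2 * n).+1, 0 <= path_y p i]%R.

(* The default value 0 of the maximum is harmless: path_y p 0 = 0. *)
Definition path_height (n : nat) (p : (2 * n).-tuple bool) : int :=
  (\big[Num.max/0]_(i < (2 * n).+1) path_y p i)%R.

Definition dyck_paths (n h : nat) : {set (2 * n).-tuple bool} :=
  [set p | is_dyck p & path_height p == Posz h].

(* Main.v *)
Require Import Defs.
From mathcomp Require Import all_boot all_order all_algebra all_fingroup.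
From mathcomp Require Import classical_sets functions cardinality.
From mathcomp Require Import zify.

Set Implicit Arguments.
Unset Strict Implicit.
Unset Printing Implicit Defensive.

(* Both bijections go through words in two letters. A forest is unfolded by
   keeping a queue of trees: if the first tree is a single node, it is removed
   and [false] is written; otherwise its first child is moved into the queue
   and [true] is written. Pushing the child at the front (depth first) or at
   the back (breadth first) encodes the trees with [n + 1] nodes bijectively by
   the same words, the Dyck words of semilength [n] followed by [false].
   Depth first, the height of the tree is the height of the Dyck path.
   Breadth first, the number of [false] before the [i]-th [true] is the parent
   of node [i]; this gives the nondecreasing sequences [s] with [s_i <= i].

   These sequences also classify semiorders: sorting the elements by
   |down-set| - |up-set| makes every strict down-set an initial segment
   [0, ..., s_i - 1]. A longest chain below the element [i] continues with
   [s_i - 1], that is, node [i + 1] of the tree with its parent [s_i], so the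
   length of the semiorder plus one is the height of the tree. *)

(** * Encoding forests by words with a queue *)

(* The length of the word encoding the forest [q]. *)
Definition weight (q : seq otree) : nat :=
  sumn [seq (tree_nodes t).*2.-1 | t <- q].

(* [b = true] is breadth first, [b = false] is depth first. *)
Definition put (A : Type) (b : bool) (t u : A) (q : seq A) : seq A :=
  if b then t :: rcons q u else u :: t :: q.

(** The queue can grow, so the recursion is on the fuel [m]; the lemmas take [m] to be the weight,
    which drops by one per letter. *)
Fixpoint enc (b : bool) (m : nat) (q : seq otree) : seq bool :=
  if m is m'.+1 then
    match q with
    | [::] => [::]
    | ONode [::] :: q' => false :: enc b m' q'
    | ONode (u :: s) :: q' => true :: enc b m' (put b (ONode s) u q')
    end
  else [::].

(** The possible codes of queues of [k] trees. The condition does not involve [b], which is why both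
    encodings have the same words. *)
Fixpoint queue_word (k : nat) (w : seq bool) : bool :=
  match w with
  | [::] => k == 0
  | c :: w' => (0 < k) && queue_word (if c then k.+1 else k.-1) w'
  end.

Fixpoint dyck_from (j : nat) (w : seq bool) : bool :=
  match w with
  | [::] => j == 0
  | c :: w' => if c then dyck_from j.+1 w' else (0 < j) && dyck_from j.-1 w'
  end.

(* [L] holds the depths of the nodes waiting in the queue; the result is the
   largest depth of a node met while reading [w]. *)
Fixpoint label_max (b : bool) (L : seq nat) (w : seq bool) : nat :=
  match w, L with
  | c :: w', l :: L' =>
    if c then label_max b (put b l l.+1 L') w' else maxn l (label_max b L' w')
  | _, _ => 0
  end.

Definition queue_height (L : seq nat) (q : seq otree) : nat :=
  \max_(p <- zip L q) (p.1 + tree_height p.2).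

Lemma tree_nodes_gt0 t : 0 < tree_nodes t.
Proof. by case: t. Qed.

Lemma size_put A b (t u : A) q : size (put b t u q) = (size q).+2.
Proof. by case: b; rewrite /= ?size_rcons. Qed.

Lemma put_inj A b (t u t' u' : A) q q' :
  put b t u q = put b t' u' q' -> [/\ t = t', u = u' & q = q'].
Proof.
case: b => /= [[-> /(congr1 rev)]|[-> -> ->] //].
by rewrite !rev_rcons => -[-> /(can_inj revK) ->].
Qed.

Lemma put_surj A b (q : seq A) :
  1 < size q -> exists t u q', q = put b t u q'.
Proof.
case: q => [|t [|u q]] //= _; case: b; last by exists u, t, q.
by exists t, (last u q), (belast u q); rewrite /= -lastI.
Qed.

(** The weight is twice the number of nodes minus the number of trees, and detaching a child only
    adds a tree. *)
Lemma weight_put b s u q :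
  (weight (put b (ONode s) u q)).+1 = weight (ONode (u :: s) :: q).
Proof.
have := tree_nodes_gt0 u; rewrite /weight.
by case: b; rewrite /= ?map_rcons ?sumn_rcons /=; lia.
Qed.

Lemma weight_leaf q : weight (ONode [::] :: q) = (weight q).+1.
Proof. by []. Qed.

Lemma weight0 q : weight q = 0 -> q = [::].
Proof. by case: q => // t q; have := tree_nodes_gt0 t; rewrite /weight /=; lia. Qed.

Lemma enc_word b m q : weight q = m ->
  queue_word (size q) (enc b m q) /\ size (enc b m q) = m.
Proof.
elim: m q => [|m IH] q; first by move=> /weight0 ->.
case: q => [|[[|u s]] q] //.
- by rewrite weight_leaf => -[/IH [/= -> ->]].
rewrite -(weight_put b) => -[/IH [/= IH1 IH2]].
by rewrite IH2 -(size_put b (ONode s) u).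
Qed.

Lemma enc_inj b m q q' : weight q = m -> weight q' = m ->
  enc b m q = enc b m q' -> q = q'.
Proof.
elim: m q q' => [|m IH] q q'; first by move=> /weight0 -> /weight0 ->.
case: q => [|[[|u s]] q] //; case: q' => [|[[|u' s']] q'] //.
- by rewrite !weight_leaf => -[Hq] [Hq'] [E]; rewrite (IH _ _ Hq Hq' E).
rewrite -!(weight_put b) => -[Hq] [Hq'] [E].
by have [[->] -> ->] := put_inj (IH _ _ Hq Hq' E).
Qed.

(** The steps are undone from the end of the word: [false] restores a single node, and [true]
    reattaches one tree as the first child of another. Two trees are available there because
    [0 < k]. *)
Lemma enc_surj b k w : queue_word k w ->
  exists q, [/\ size q = k, weight q = size w & enc b (size w) q = w].
Proof.
elim: w k => [|c w IH] k /=; first by move=> /eqP ->; exists [::].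
move=> /andP[k_gt0 /IH [q [szq wq eq]]]; case: c szq => szq; last first.
  exists (ONode [::] :: q); rewrite /= szq eq prednK //.
  by rewrite weight_leaf wq.
have [[s] [u [q' Eq]]] : exists t u q', q = put b t u q'.
  by apply: put_surj; rewrite szq.
exists (ONode (u :: s) :: q'); rewrite -(weight_put b) -Eq wq eq; split=> //.
by move: szq; rewrite Eq size_put => -[].
Qed.

Lemma zip_put A B b (t u : A) (t' u' : B) q q' : size q = size q' ->
  zip (put b t u q) (put b t' u' q') = put b (t, t') (u, u') (zip q q').
Proof. by case: b => //= eq; rewrite zip_rcons. Qed.

Lemma big_put A b (t u : A) q (F : A -> nat) :
  \max_(x <- put b t u q) F x = maxn (maxn (F t) (F u)) (\max_(x <- q) F x).
Proof.
case: b; rewrite /= ?big_cons ?big_rcons /=; last by lia.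
by rewrite -maxnA [maxn (F u) _]maxnC.
Qed.

(** Detaching a child keeps the maximum, since its label exceeds that of its parent by one; a
    removed leaf contributes its own depth. *)
Lemma label_max_enc b m L q : weight q = m -> size L = size q ->
  label_max b L (enc b m q) = queue_height L q.
Proof.
elim: m L q => [|m IH] L q.
  by move=> /weight0 -> /size0nil ->; rewrite /queue_height big_nil.
case: q L => [|[[|u s]] q] [|l L] //.
- rewrite weight_leaf => -[Hq] [HL] /=.
  by rewrite IH // /queue_height /= big_cons addn0.
rewrite -(weight_put b) => -[Hq] [HL] /=.
rewrite IH ?size_put ?HL // /queue_height zip_put // big_put /= big_cons /=.
by congr maxn; lia.
Qed.

(** * Trees with [n.+1] nodes and Dyck words *)

(** The queue is one longer than the path is high; the final [false] removes the last tree. *)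
Lemma queue_word_rcons k w :
  queue_word k.+1 (rcons w false) = dyck_from k w.
Proof.
by elim: w k => [|[] w IH] [|k] //=; case: w {IH}.
Qed.

Lemma queue_word_last k w : 0 < k -> queue_word k w ->
  exists w', w = rcons w' false.
Proof.
move=> k_gt0; case/lastP: w => [|w c]; first by case: k k_gt0.
case: c; last by exists w.
suff /negPf -> : ~~ queue_word k (rcons w true) by [].
elim: w k {k_gt0} => [|c w IH] k /=; first by rewrite andbF.
by rewrite negb_and IH orbT.
Qed.

(** The last letter of the code, always [false], is dropped. The default of [insubd] is not reached
    when [t] has [n.+1] nodes. *)
Definition tree_word (b : bool) (n : nat) (t : otree) : (2 * n).-tuple bool :=
  insubd [tuple of nseq (2 * n) false] (take (2 * n) (enc b (2 * n).+1 [:: t])).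

Definition words_of_height (b : bool) (n h : nat) : {set (2 * n).-tuple bool} :=
  [set p : (2 * n).-tuple bool | dyck_from 0 p & label_max b [:: 0] (rcons p false) == h].

Lemma tree_wordP b n t : tree_nodes t = n.+1 ->
  enc b (2 * n).+1 [:: t] = rcons (tree_word b n t) false.
Proof.
move=> Ht; have wt : weight [:: t] = (2 * n).+1 by rewrite /weight /= Ht; lia.
have [Hw Hs] := enc_word b wt; have [w' Ew] := queue_word_last (ltn0Sn 0) Hw.
move: Hs; rewrite /tree_word Ew size_rcons => -[Hs].
by rewrite -cats1 -Hs take_size_cat // val_insubd Hs eqxx cats1.
Qed.

Lemma tree_word_dyck b n t : tree_nodes t = n.+1 -> dyck_from 0 (tree_word b n t).
Proof.
move=> Ht; have wt : weight [:: t] = (2 * n).+1 by rewrite /weight /= Ht; lia.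
by have [] := enc_word b wt; rewrite tree_wordP // queue_word_rcons.
Qed.

Lemma tree_word_height b n t : tree_nodes t = n.+1 ->
  label_max b [:: 0] (rcons (tree_word b n t) false) = tree_height t.
Proof.
move=> Ht; have wt : weight [:: t] = (2 * n).+1 by rewrite /weight /= Ht; lia.
by rewrite -tree_wordP // label_max_enc // /queue_height /= big_seq1.
Qed.

Lemma tree_word_inj b n t t' : tree_nodes t = n.+1 -> tree_nodes t' = n.+1 ->
  tree_word b n t = tree_word b n t' -> t = t'.
Proof.
move=> Ht Ht' E.
have wt u : tree_nodes u = n.+1 -> weight [:: u] = (2 * n).+1.
  by rewrite /weight /= => ->; lia.
suff [] : [:: t] = [:: t'] by [].
by apply: (@enc_inj b (2 * n).+1); rewrite ?wt // !tree_wordP // E.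
Qed.

Lemma tree_word_surj b n (p : (2 * n).-tuple bool) : dyck_from 0 p ->
  exists2 t, tree_nodes t = n.+1 & tree_word b n t = p.
Proof.
rewrite -queue_word_rcons => /(enc_surj b) [q [szq wq Ep]].
case: q szq wq Ep => [|t [|? ?]] // _.
rewrite size_rcons size_tuple => wt Ep.
have Ht : tree_nodes t = n.+1 by move: wt; rewrite /weight /=; lia.
exists t => //; move: Ep; rewrite tree_wordP // => /rcons_inj [] E.
exact: val_inj.
Qed.

Lemma card_eq_finset (T : finType) (A : {set T}) :
  ([set x | x \in A]%classic #= `I_#|A|)%card.
Proof.
have <- : (@enum_val T (mem A) @` [set: 'I_#|A|] = [set x | x \in A])%classic.
  apply/seteqP; split=> [_ [i _ <-] | x /= Ax]; first exact: enum_valP.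
  by exists (enum_rank_in Ax x); rewrite // enum_rankK_in.
rewrite (card_eqr card_II); apply: inj_card_eq => i j _ _; exact: enum_val_inj.
Qed.

(** Keeping [b] arbitrary lets the trees link the breadth-first words with the depth-first ones. *)
Lemma card_ordered_trees b n h :
  (ordered_trees n.+1 h #= `I_#|words_of_height b n h|)%card.
Proof.
apply: card_eq_trans (card_eq_finset _).
have <- : (tree_word b n @` ordered_trees n.+1 h =
   [set p | p \in words_of_height b n h])%classic.
  apply/seteqP; split=> [_ [t [Ht hh] <-] | p] /=; rewrite inE.
    by rewrite tree_word_dyck // tree_word_height // hh eqxx.
  move=> /andP[/(tree_word_surj b) [t Ht <-]]; rewrite tree_word_height //.
  by move=> /eqP; exists t.
rewrite card_eq_sym; apply: inj_card_eq => t t' /set_mem [Ht _] /set_mem [Ht' _].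
exact: tree_word_inj.
Qed.

(** * Depth first: tree height and path height *)

Lemma path_y_cons c w i :
  path_y (c :: w) i.+1 = ((if c then 1 else -1) + path_y w i)%R.
Proof. by rewrite /path_y /= big_cons. Qed.

Lemma path_y0 w : path_y w 0 = 0%R.
Proof. by rewrite /path_y take0 big_nil. Qed.

Lemma dyck_fromP j w :
  reflect ((Posz j + path_y w (size w))%R = 0%R /\
           forall i, i <= size w -> (0 <= Posz j + path_y w i)%R)
          (dyck_from j w).
Proof.
apply: (iffP idP).
  elim: w j => [|c w IH] j /=.
    by move=> /eqP ->; split=> [|[|i]] //; rewrite path_y0.
  case: c => [/IH|/andP[j_gt0 /IH]] [E P]; split=> [|[|i] /= Hi];
    rewrite ?path_y0 ?path_y_cons; try (move: (P i Hi)); lia.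
elim: w j => [|c w IH] j /= [E P].
  by move: E; rewrite path_y0; lia.
move: E; rewrite path_y_cons => E.
have P' i : i <= size w -> (0 <= Posz j + ((if c then 1 else -1) + path_y w i))%R.
  by move=> Hi; rewrite -path_y_cons; apply: P.
case: c E P P' => E P P'.
  by apply: IH; split=> [|i /P']; lia.
have j_gt0 : 0 < j by have := P' 0 isT; rewrite path_y0; lia.
by rewrite j_gt0; apply: IH; split=> [|i /P']; lia.
Qed.

Fixpoint dyck_max (j : nat) (w : seq bool) : nat :=
  if w is c :: w' then maxn j (dyck_max (if c then j.+1 else j.-1) w') else j.

Lemma dyck_max_ge j w : j <= dyck_max j w.
Proof. by case: w => //= c w; apply: leq_maxl. Qed.

Lemma dyck_max_path j w : dyck_from j w ->
  Posz (dyck_max j w) =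
  \big[Num.max/0%R]_(i < (size w).+1) (Posz j + path_y w i)%R.
Proof.
elim: w j => [|c w IH] j /=.
  by move=> /eqP ->; rewrite big_ord_recl big_ord0 path_y0.
move=> Hw; rewrite big_ord_recl path_y0 GRing.addr0.
have E : forall i : 'I_(size w).+1, (Posz j + path_y (c :: w) (lift ord0 i) =
    Posz (if c then j.+1 else j.-1) + path_y w i)%R.
  by move=> i; rewrite lift0 path_y_cons; case: c Hw => [_|/andP[]]; lia.
rewrite (eq_bigr _ (fun i _ => E i)) -IH; last by case: c Hw {E} => // /andP[].
lia.
Qed.

(** The queue holds the current node and its ancestors, of depths j, ..., 0, so the front depth
    moves like the height of the path. *)
Lemma label_max_dfs j w : dyck_from j w ->
  label_max false (rev (iota 0 j.+1)) (rcons w false) = dyck_max j w.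
Proof.
have revS k : rev (iota 0 k.+1) = k :: rev (iota 0 k).
  by rewrite -addn1 iotaD rev_cat.
elim: w j => [|[] w IH] j Hw.
- by rewrite (eqP Hw).
- have := IH _ Hw; rewrite !revS /= => ->.
  by have := dyck_max_ge j.+1 w; lia.
- case: j Hw => // j Hw; rewrite revS /= -[dyck_max j w]IH //.
Qed.

Lemma words_of_height_dfs n h : words_of_height false n h = dyck_paths n h.
Proof.
apply/setP => p; rewrite !inE.
have -> : is_dyck p = dyck_from 0 p.
  rewrite /is_dyck; apply/andP/dyck_fromP; rewrite size_tuple GRing.add0r.
    case=> /eqP -> /forallP P; split=> // i Hi; rewrite GRing.add0r.
    exact: (P (Ordinal (Hi : i < (2 * n).+1))).
  case=> -> P; split=> //; apply/forallP => i.
  by have := P i (ltn_ord i); rewrite GRing.add0r.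
case Hp: (dyck_from 0 p) => //=.
rewrite (label_max_dfs Hp) -(inj_eq (can_inj absz_nat)) (dyck_max_path Hp) size_tuple.
by congr (_ == _); apply: eq_bigr => i _; rewrite GRing.add0r.
Qed.

(** * Dyck words and nondecreasing sequences *)

Fixpoint down_sizes (a : nat) (w : seq bool) : seq nat :=
  match w with
  | [::] => [::]
  | c :: w' => if c then a :: down_sizes a w' else down_sizes a.+1 w'
  end.

Lemma down_sizes_path a w : path leq a (down_sizes a w).
Proof.
elim: w a => [|[] w IH] a //=; first by rewrite leqnn IH.
by move: (IH a.+1); apply: path_le => //; apply: leq_trans.
Qed.

(** The list forgets only the trailing run of [false], which the length of the word restores. *)
Lemma down_sizes_inj a w w' : size w = size w' ->
  down_sizes a w = down_sizes a w' -> w = w'.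
Proof.
have lt v x v' : down_sizes x.+1 v = x :: v' -> False.
  by move=> E; have := down_sizes_path x.+1 v; rewrite E /= ltnn.
elim: w w' a => [|[] w IH] [|[] w'] a //= [Hs].
- by move=> [/(IH _ _ Hs) ->].
- by move/esym/lt.
- by move/lt.
- by move=> /(IH _ _ Hs) ->.
Qed.

(** Here and in the next lemmas, [a] and [b] count the letters [false] and [true] already read, so
    [b - a] is the current height. *)
Lemma size_down_sizes a b w : a <= b -> dyck_from (b - a) w ->
  size w = 2 * size (down_sizes a w) + (b - a).
Proof.
elim: w a b => [|[] w IH] a b leab /=; first by move=> /eqP ->.
- by rewrite -subSn // => /IH ->; rewrite ?(leqW leab) //; lia.
- by case/andP=> ltab; rewrite -subnS => /IH ->; lia.
Qed.

Lemma nth_down_sizes a b w i : a <= b -> dyck_from (b - a) w ->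
  i < size (down_sizes a w) -> nth 0 (down_sizes a w) i <= b + i.
Proof.
elim: w a b i => [|[] w IH] a b i leab //=.
- rewrite -subSn //; case: i => [|i] Hw Hi; first by rewrite /= addn0.
  by rewrite -addSnnS; apply: IH => //; apply: leqW.
- by case/andP=> ltab; rewrite -subnS; apply: IH; lia.
Qed.

(** Before each entry [x], a run of [x - a] letters [false] brings the count up to [x]; the bounds
    on the entries keep the path above the axis. *)
Lemma down_sizes_surj a b s : a <= b -> path leq a s ->
  (forall i, i < size s -> nth 0 s i <= b + i) ->
  exists w, [/\ dyck_from (b - a) w, down_sizes a w = s
              & size w = 2 * size s + (b - a)].
Proof.
have dyck_nseq i j w : i <= j ->
    dyck_from j (nseq i false ++ w) = dyck_from (j - i) w.
  elim: i j => [|i IH] [|j] //=; by rewrite ltnS => /IH.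
have down_nseq i x w : down_sizes x (nseq i false ++ w) = down_sizes (x + i) w.
  by elim: i x => [|i IH] x /=; rewrite ?addn0 // IH addSnnS.
elim: s a b => [|x s IH] a b leab /=.
  (* The final run of [false] brings the path back to the axis. *)
  move=> _ _; exists (nseq (b - a) false).
  by rewrite -[nseq _ _]cats0 dyck_nseq // down_nseq subnn /= cats0 size_nseq.
case/andP=> leax Hs P; have lexb : x <= b by have := P 0 isT; rewrite addn0.
have [|i Hi|w [W1 W2 W3]] := IH x b.+1 _ Hs; first exact: leqW.
  by rewrite addSnnS; apply: (P i.+1).
exists (nseq (x - a) false ++ true :: w).
rewrite dyck_nseq ?down_nseq ?leq_sub2r // subnKC //= W2.
rewrite size_cat size_nseq /= W3; split=> //; last by lia.
by have -> : (b - a - (x - a)).+1 = b.+1 - x by lia.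
Qed.

(** * Breadth first: depths of the nodes *)

(* [s] is read as the parent function of a tree on the nodes [0, ..., size s]
   in which node [i.+1] has parent [nth 0 s i]. *)
Definition depth_fun (s : seq nat) (f : nat -> nat) : Prop :=
  f 0 = 0 /\ forall i, i < size s -> f i.+1 = (f (nth 0 s i)).+1.

Lemma depth_fun_exists s : (forall i, i < size s -> nth 0 s i <= i) ->
  exists f, depth_fun s f.
Proof.
elim/last_ind: s => [|s x IH] P; first by exists (fun=> 0).
rewrite /depth_fun size_rcons in P *.
have [i Hi|f [f0 fS]] := IH.
  by have := P i (leqW Hi); rewrite nth_rcons Hi.
(* The appended node has parent [x], an older node because [x <= size s]. *)
exists (fun i => if i <= size s then f i else (f x).+1); split=> // i.
rewrite ltnS leq_eqVlt => /orP[/eqP ->|Hi].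
  have := P (size s) (leqnn _).
  by rewrite ltnn nth_rcons ltnn eqxx => ->.
have := P i (leqW Hi); rewrite Hi nth_rcons Hi fS // => Hle.
by rewrite (leq_trans Hle (ltnW Hi)).
Qed.

(* In the breadth-first encoding the queue holds consecutive nodes [a, ..., b]
   of the tree described by [depth_fun]. *)
Lemma label_max_bfs f a b n w : a <= b -> dyck_from (b - a) w ->
  b + size (down_sizes a w) = n ->
  (forall i, i < size (down_sizes a w) ->
     f (b + i).+1 = (f (nth 0 (down_sizes a w) i)).+1) ->
  label_max true [seq f i | i <- iota a (b - a).+1] (rcons w false) =
  \max_(a <= i < n.+1) f i.
Proof.
elim: w a b => [|[] w IH] a b leab /=.
- rewrite subn_eq0 => leba; have -> : a = b by lia.
  by move=> <- _; rewrite addn0 big_nat1 maxn0.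
- rewrite -subSn // => Hw Hn Hf.
  rewrite -(IH a b.+1) ?(leqW leab) //; last first.
  + by move=> i Hi; rewrite addSnnS; apply: (Hf i.+1).
  + by rewrite addSnnS.
  rewrite subSn //.
  (* The next entry of the sequence is [a], so the new node [b.+1] is a child of the front node
     [a]. *)
  have := Hf 0 isT; rewrite addn0 /= => <-.
  have E : iota a.+1 (b - a).+1 = rcons (iota a.+1 (b - a)) b.+1.
    by rewrite -[(b - a).+1]addn1 iotaD -cats1 /= addSn subnKC.
  by rewrite -map_rcons -E.
- case/andP => ltab; rewrite -subnS => Hw Hn Hf.
  rewrite big_ltn; last by lia.
  rewrite -(IH a.+1 b) //; first by rewrite subnSK; lia.
  by lia.
Qed.

(** * The semiorder of a nondecreasing sequence *)

Definition prefix_order (n : nat) (s : seq nat) : {set 'I_n * 'I_n} :=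
  [set p : 'I_n * 'I_n | (p.1 == p.2) || (p.1 < nth 0 s p.2)].

Definition parent_seq (n : nat) (s : seq nat) : Prop :=
  [/\ size s = n, sorted leq s & forall i, i < size s -> nth 0 s i <= i].

Lemma parent_seq_le n s (i j : 'I_n) : parent_seq n s -> i <= j ->
  nth 0 s i <= nth 0 s j.
Proof.
case=> sz Hs _ leij.
by apply: (sorted_leq_nth leq_trans leqnn) => //; rewrite inE sz.
Qed.

Lemma parent_seq_bound n s (i : 'I_n) : parent_seq n s -> nth 0 s i <= i.
Proof. by case=> sz _; apply; rewrite sz. Qed.

Lemma ple_prefix n s (x y : 'I_n) :
  ple (prefix_order n s) x y = (x == y) || (x < nth 0 s y).
Proof. by rewrite /ple inE. Qed.

Lemma pgt_prefix n s (x y : 'I_n) : parent_seq n s ->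
  pgt (prefix_order n s) x y = (y < nth 0 s x).
Proof.
move=> Hs; rewrite /pgt ple_prefix eq_sym.
case: (eqVneq y x) => [->|] //=; have := parent_seq_bound x Hs; lia.
Qed.

(** A 2+2 would give y < s_x <= w < s_z <= y. In a 3+1, w >= s_x > y, so monotonicity gives s_w >=
    s_y > z and puts w above z. *)
Lemma prefix_semiorder n s : parent_seq n s -> is_semiorder (prefix_order n s).
Proof.
move=> Hs; apply/and3P; split.
- apply/and3P; split.
  + by apply/forallP => x; rewrite ple_prefix eqxx.
  + apply/forallP => x; apply/forallP => y; rewrite !ple_prefix.
    apply/implyP => /andP[/orP[//|xy] /orP[|yx]]; first by rewrite eq_sym.
    have := parent_seq_bound x Hs; have := parent_seq_bound y Hs; lia.
  + apply/forallP => x; apply/forallP => y; apply/forallP => z.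
    rewrite !ple_prefix; apply/implyP => /andP[/orP[/eqP -> //|xy]].
    move=> /orP[/eqP <-|yz]; first by rewrite xy orbT.
    by have := parent_seq_bound y Hs; lia.
- apply/negP => /existsP[x] /existsP[y] /existsP[z] /existsP[w].
  rewrite /incomparable !pgt_prefix // !ple_prefix => /and5P[_ yx wz _].
  by move=> /and3P[xw yz _]; lia.
- apply/negP => /existsP[x] /existsP[y] /existsP[z] /existsP[w].
  rewrite /incomparable !pgt_prefix // !ple_prefix => /and5P[_ yx zy wx].
  move=> /andP[_ wz]; have /(parent_seq_le Hs) : y <= w by lia.
  by lia.
Qed.

(* [f x.+1] is the size of a longest chain with top element [x]. *)
Lemma prefix_length n s f : 0 < n -> parent_seq n s -> depth_fun s f ->
  (poset_length (prefix_order n s)).+1 = \max_(0 <= i < n.+1) f i.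
Proof.
move=> n_gt0 Hs [f0 fS]; have [sz _ _] := Hs.
have fSo (x : 'I_n) : f x.+1 = (f (nth 0 s x)).+1 by rewrite fS ?sz.
(* Depths increase weakly along the nodes, because later nodes have later parents; so the last node
   is a deepest one. *)
have f_mono i j : i <= j -> j <= n -> f i <= f j.
  elim/ltn_ind: j i => -[|j] IH [|i] //; rewrite ?f0 // => leij lejn.
  have ltin : i < n by apply: leq_trans lejn.
  rewrite (fSo (Ordinal ltin)) (fSo (Ordinal lejn)) ltnS.
  have := parent_seq_bound (Ordinal lejn) Hs => Hb.
  apply: IH => //; last by apply: leq_trans Hb (ltnW lejn).
  exact: (parent_seq_le Hs).
have -> : \max_(0 <= i < n.+1) f i = f n.
  apply/eqP; rewrite eqn_leq; apply/andP; split.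
    rewrite big_mkord; apply/bigmax_leqP => i _.
    by apply: f_mono => //; rewrite -ltnS.
  by rewrite big_mkord (leq_bigmax (ord_max : 'I_n.+1)).
have lt_last : n.-1 < n by rewrite prednK.
pose last_n := Ordinal lt_last.
have fn : f n = f last_n.+1 by rewrite /= prednK.
have f_lt (x y : 'I_n) : pgt (prefix_order n s) x y -> f y.+1 < f x.+1.
  rewrite pgt_prefix // => Hyx; rewrite [f x.+1]fSo ltnS.
  apply: f_mono => //; apply: leq_trans (parent_seq_bound x Hs) (ltnW _).
  exact: ltn_ord.
(* The bound [z <= x] makes the induction work: a chain with top s_x - 1 has all its indices below
   s_x, hence lies under [x]. *)
have chain_of (x : 'I_n) : exists C : {set 'I_n},
    [/\ is_chain (prefix_order n s) C, forall z, z \in C -> z <= x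
      & #|C| = f x.+1].
  have [m] := ubnP x; elim: m x => // m IH x; rewrite ltnS => lexm.
  have [sx0|sx_gt0] := posnP (nth 0 s x).
    exists [set x]; rewrite cards1 fSo sx0 f0; split=> // [|z /set1P -> //].
    apply/forall_inP => y /set1P ->; apply/forall_inP => z /set1P ->.
    by rewrite ple_prefix eqxx.
  have Hb := parent_seq_bound x Hs.
  have lty : (nth 0 s x).-1 < n by have := ltn_ord x; lia.
  have [|C [HC leC cardC]] := IH (Ordinal lty); first by rewrite /=; lia.
  have leC' z : z \in C -> z < nth 0 s x by move=> /leC /=; lia.
  exists (x |: C); split.
  - apply/forall_inP => y /setU1P[->|Cy]; apply/forall_inP => z /setU1P[->|Cz].
    + by rewrite ple_prefix eqxx.
    + by rewrite !ple_prefix (leC' z Cz) !orbT.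
    + by rewrite !ple_prefix (leC' y Cy) !orbT.
    + by have /forall_inP/(_ y Cy)/forall_inP/(_ z Cz) := HC.
  - by move=> z /setU1P[-> //|/leC']; lia.
  - rewrite cardsU1 cardC [f x.+1]fSo /= prednK //.
    by case: (boolP (x \in C)) => // /leC'; lia.
apply/eqP; rewrite eqn_leq; apply/andP; split; last first.
  have [C [HC _ cardC]] := chain_of last_n.
  rewrite fn -cardC.
  suff : #|C|.-1 <= poset_length (prefix_order n s) by lia.
  exact: (@leq_bigmax_cond _ _ (fun C : {set 'I_n} => #|C|.-1)).
rewrite fn fSo ltnS; apply/bigmax_leqP => C HC.
suff : #|C| <= f last_n.+1 by rewrite fSo; lia.
(* By [f_lt] the depths along a chain are distinct, and they lie between 1 and the depth of the last
   node. *)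
rewrite cardE -(size_map (fun x : 'I_n => f x.+1)) -(size_iota 1 (f last_n.+1)).
apply: uniq_leq_size.
  rewrite map_inj_in_uniq ?enum_uniq // => x y; rewrite !mem_enum => Cx Cy Exy.
  apply: contra_eq Exy => neq_xy.
  have /forall_inP/(_ x Cx)/forall_inP/(_ y Cy)/orP[xy|yx] := HC.
    by rewrite neq_ltn (f_lt y x) // /pgt (eq_sym y) neq_xy.
  by rewrite neq_ltn (f_lt x y) ?orbT // /pgt neq_xy.
move=> _ /mapP[x _ ->]; rewrite mem_iota fSo add1n ltnS /= -!fSo.
by apply: f_mono => //=; rewrite prednK.
Qed.

(** * The sequence as an isomorphism invariant *)

Lemma card_below n m : m <= n -> #|[set y : 'I_n | y < m]| = m.
Proof.
move=> lemn; have widen_inj : injective (widen_ord lemn).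
  by move=> x y /(congr1 val) /= Exy; apply: val_inj.
rewrite -[RHS]card_ord -(card_imset _ widen_inj).
apply: eq_card => y; rewrite inE; apply/idP/imsetP => [ltym|[x _ ->]] //=.
by exists (Ordinal ltym) => //; apply: val_inj.
Qed.

Lemma down_closed_below n (A : {set 'I_n}) :
  (forall i j : 'I_n, i <= j -> j \in A -> i \in A) ->
  forall i, (i \in A) = (i < #|A|).
Proof.
move=> HA i; apply/idP/idP => [Ai|].
  rewrite -(card_below (ltn_ord i)).
  by apply/subset_leq_card/fintype.subsetP => y; rewrite inE ltnS => /HA; apply.
apply: contraTT => nAi; rewrite -leqNgt -[leqRHS](card_below (ltnW (ltn_ord i))).
apply/subset_leq_card/fintype.subsetP => y Ay; rewrite inE ltnNge.
by apply: contra nAi => /HA; apply.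
Qed.

(** The sequence is the sorted list of the sizes of strict down-sets, and an isomorphism only
    permutes these sizes. *)
Lemma prefix_order_inj n s s' : parent_seq n s -> parent_seq n s' ->
  poset_iso (prefix_order n s) (prefix_order n s') -> s = s'.
Proof.
move=> Hs Hs' /existsP[sg /forallP Hsg].
have card_dn r (x : 'I_n) : parent_seq n r ->
    #|[set y | pgt (prefix_order n r) x y]| = nth 0 r x.
  move=> Hr; have lern : nth 0 r x <= n.
    exact: leq_trans (parent_seq_bound x Hr) (ltnW (ltn_ord x)).
  rewrite -[RHS](card_below lern).
  by apply: eq_card => y; rewrite !inE pgt_prefix.
have E (x : 'I_n) : nth 0 s x = nth 0 s' (sg x).
  rewrite -!card_dn // -(card_imset _ (@perm_inj _ sg)); apply: eq_card => y.
  rewrite -[y](permKV sg) mem_imset; last exact: perm_inj.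
  rewrite !inE /pgt (inj_eq perm_inj).
  by have /forallP/(_ x)/eqP -> := Hsg ((sg^-1)%g y).
have enumE r : parent_seq n r -> [seq nth 0 r (val x) | x <- enum 'I_n] = r.
  by case=> <- _ _; rewrite (map_comp (nth 0 r) val) val_enum_ord; apply: mkseq_nth.
have [_ sorted_s _] := Hs; have [_ sorted_s' _] := Hs'.
apply: (sorted_eq leq_trans anti_leq) => //.
rewrite -(enumE s) // -(enumE s') //.
rewrite (eq_map E) (map_comp (fun x : 'I_n => nth 0 s' x) sg); apply: perm_map.
apply: uniq_perm; rewrite ?(map_inj_uniq perm_inj) ?enum_uniq // => y.
by rewrite mem_enum -[y](permKV sg) map_f // mem_enum.
Qed.

(** * Nested down-sets and up-sets in a semiorder *)

Section Semiorder.

Variables (T : finType) (R : {set T * T}).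
Hypothesis HR : is_semiorder R.

Lemma semiorder_refl x : ple R x x.
Proof. by have /and3P[/and3P[/forallP]] := HR. Qed.

Lemma semiorder_anti x y : ple R x y -> ple R y x -> x = y.
Proof.
have /and3P[/and3P[_ /forallP/(_ x)/forallP/(_ y)/implyP H _] _ _] := HR.
by move=> xy yx; apply/eqP/H; rewrite xy.
Qed.

Lemma semiorder_trans y x z : ple R x y -> ple R y z -> ple R x z.
Proof.
have /and3P[/and3P[_ _]] := HR.
move=> /forallP/(_ x)/forallP/(_ y)/forallP/(_ z)/implyP H _ _.
by move=> xy yz; apply: H; rewrite xy.
Qed.

Lemma pgt_le_trans x y z : pgt R x y -> ple R x z -> pgt R z y.
Proof.
move=> /andP[neq yx] xz; rewrite /pgt (semiorder_trans yx xz) andbT.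
by apply: contra neq => /eqP Ezy; rewrite (semiorder_anti yx) // -Ezy.
Qed.

Lemma le_pgt_trans x y z : pgt R x y -> ple R z y -> pgt R x z.
Proof.
move=> /andP[neq yx] zy; rewrite /pgt (semiorder_trans zy yx) andbT.
by apply: contra neq => /eqP Exz; rewrite (semiorder_anti yx) // Exz.
Qed.

Lemma incomparable_neq x y : incomparable R x y -> x != y.
Proof. by apply: contraTneq => ->; rewrite /incomparable semiorder_refl. Qed.

Lemma pgt_neq x y : pgt R x y -> x != y.
Proof. by case/andP. Qed.

Lemma pgt_irr x : pgt R x x = false.
Proof. by rewrite /pgt eqxx. Qed.

(** This makes strict down-sets, and dually strict up-sets, nested. Transitivity turns the two
    failing relations into all the incomparabilities of a 2+2. *)
Lemma semiorder_2plus2 x v y w : pgt R x v -> pgt R y w ->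
  ~~ pgt R y v -> ~~ pgt R x w -> False.
Proof.
move=> xv yw nyv nxw; have /and3P[_ /negP H _] := HR; apply: H.
have Ixy : incomparable R x y.
  by apply/andP; split; [apply: contra nyv => /(pgt_le_trans xv)
                        |apply: contra nxw => /(pgt_le_trans yw)].
have Ixw : incomparable R x w.
  apply/andP; split.
    by apply: contra nyv => /(pgt_le_trans xv)/andP[_]; apply: le_pgt_trans.
  apply: contra nxw => wx; rewrite /pgt wx andbT.
  by apply: contra nyv => /eqP Exw; rewrite Exw in xv; case/andP: xv => _;
     apply: le_pgt_trans.
have Ivy : incomparable R v y.
  apply/andP; split.
    apply: contra nyv => vy; rewrite /pgt vy andbT.
    by apply: contra nxw => /eqP Eyv; rewrite Eyv in yw; case/andP: yw => _;
       apply: le_pgt_trans.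
  by apply: contra nxw => /(pgt_le_trans yw)/andP[_]; apply: le_pgt_trans.
have Ivw : incomparable R v w.
  by apply/andP; split; [apply: contra nyv | apply: contra nxw];
     apply: le_pgt_trans.
apply/existsP; exists x; apply/existsP; exists v.
apply/existsP; exists y; apply/existsP; exists w.
rewrite xv yw Ixy Ixw Ivy Ivw /= !inE !negb_or.
by rewrite (pgt_neq xv) (pgt_neq yw) !incomparable_neq.
Qed.

(** Again by transitivity, the two failing relations make [w] incomparable to the whole chain. *)
Lemma semiorder_3plus1 x y z w : pgt R x y -> pgt R y z ->
  ~~ pgt R x w -> ~~ pgt R w z -> False.
Proof.
move=> xy yz nxw nwz; have /and3P[_ _ /negP H] := HR; apply: H.
have Iwy : incomparable R w y.
  by apply/andP; split; [apply: contra nxw | apply: contra nwz];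
    [apply: le_pgt_trans | apply: pgt_le_trans].
have Iwx : incomparable R w x.
  apply/andP; split.
    apply: contra nxw => wx; rewrite /pgt wx andbT.
    by apply: contra nwz => /eqP <-; case/andP: xy => _; apply: pgt_le_trans.
  by apply: contra nwz => xw; apply: pgt_le_trans yz (semiorder_trans _ xw); case/andP: xy.
have Iwz : incomparable R w z.
  apply/andP; split.
    by apply: contra nxw => wz; apply: le_pgt_trans xy (semiorder_trans wz _); case/andP: yz.
  apply: contra nwz => zw; rewrite /pgt zw andbT.
  by apply: contra nxw => /eqP ->; case/andP: yz => _; apply: le_pgt_trans.
apply/existsP; exists x; apply/existsP; exists y.
apply/existsP; exists z; apply/existsP; exists w.
rewrite xy yz Iwx Iwy Iwz /= !inE !negb_or.
have xz : pgt R x z by apply: le_pgt_trans xy _; case/andP: yz.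
rewrite (pgt_neq xy) (pgt_neq yz) (pgt_neq xz) (eq_sym x w) (eq_sym y w).
by rewrite (eq_sym z w) !incomparable_neq.
Qed.

Definition downs x := [set y | pgt R x y].
Definition ups x := [set y | pgt R y x].
(** The shift by [#|T|] keeps the subtraction on [nat] from truncating. *)
Definition rank x := #|T| + #|downs x| - #|ups x|.

(** If the inclusion of down-sets fails, nestedness makes [downs y] strictly smaller, and the ranks
    then force some w above x but not above y. With v below x but not below y, the chain w > x > v
    and y contradict 3+1-freeness. The other inclusion is dual. *)
Lemma rank_monotone x y : rank x <= rank y ->
  (downs x \subset downs y) && (ups y \subset ups x).
Proof.
have le_ups z : #|ups z| <= #|T| by apply: max_card.
move: (le_ups x) (le_ups y); rewrite /rank => lex ley Hxy.
have nested (a b v w : T) : v \in downs a -> v \notin downs b ->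
    w \in ups a -> w \notin ups b -> False.
  rewrite !inE => av nbv wa nwb.
  exact: (semiorder_3plus1 wa av nwb nbv).
apply/andP; split; apply/negPn/negP => /subsetPn[v].
- move=> Dv nDv; have /proper_card ltD : downs y \proper downs x.
    apply/properP; split; last by exists v.
    apply/fintype.subsetP => w; rewrite !inE in Dv nDv * => yw.
    by apply/negPn/negP => nxw; apply: semiorder_2plus2 Dv yw nDv nxw.
  have : ~~ (ups x \subset ups y) by apply/negP => /subset_leq_card; lia.
  by case/subsetPn => w ? ?; apply: (nested x y v w).
- move=> Uv nUv; have /proper_card ltU : ups x \proper ups y.
    apply/properP; split; last by exists v.
    apply/fintype.subsetP => w; rewrite !inE in Uv nUv * => wx.
    by apply/negPn/negP => nwy; apply: semiorder_2plus2 Uv wx nwy nUv.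
  have : ~~ (downs y \subset downs x) by apply/negP => /subset_leq_card; lia.
  by case/subsetPn => w ? ?; apply: (nested y x w v).
Qed.
End Semiorder.

(** * Every semiorder comes from a sequence *)

Lemma semiorder_prefix n (R : {set 'I_n * 'I_n}) : is_semiorder R ->
  exists2 s, parent_seq n s & poset_iso (prefix_order n s) R.
Proof.
move=> HR; pose e := sort (relpre (rank R) leq) (enum 'I_n).
have size_e : size e = n by rewrite size_sort size_enum_ord.
have uniq_e : uniq e by rewrite sort_uniq enum_uniq.
pose g (i : 'I_n) := nth i e i.
have g_inj : injective g.
  move=> i j; rewrite /g (set_nth_default i j) ?size_e // => /eqP.
  by rewrite nth_uniq ?size_e // => /eqP/val_inj.
have g_rank (i j : 'I_n) : i <= j -> rank R (g i) <= rank R (g j).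
  move=> leij; rewrite /g (set_nth_default i j) ?size_e //.
  apply: (@sorted_leq_nth _ (relpre (rank R) leq)) => //.
  - by move=> x y z /=; apply: leq_trans.
  - by move=> x /=.
  - by apply: sort_sorted => x y /=; apply: leq_total.
  - by rewrite inE size_e.
  - by rewrite inE size_e.
pose sg := perm g_inj.
pose s := [seq #|downs R (g i)| | i <- enum 'I_n].
have nth_s (i : 'I_n) : nth 0 s i = #|downs R (g i)|.
  by rewrite (nth_map i) ?size_enum_ord // nth_ord_enum.
(* Up-sets shrink as the rank grows, so the positions below [g y] form an initial segment,
   determined by its size. *)
have pgt_g (x y : 'I_n) : pgt R (g y) (g x) = (x < nth 0 s y).
  have -> : nth 0 s y = #|[set i | pgt R (g y) (g i)]|.
    rewrite nth_s -[RHS](card_imset _ g_inj); apply: eq_card => z.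
    have -> : z = g (sg^-1 z)%g by rewrite -(permE g_inj) permKV.
    by rewrite mem_imset // !inE.
  rewrite -(@down_closed_below _ [set i | _]); first by rewrite inE.
  move=> i j leij; rewrite !inE => yj.
  have /andP[_ /fintype.subsetP/(_ (g y))] := rank_monotone HR (g_rank _ _ leij).
  by rewrite !inE; apply.
exists s.
  split; first by rewrite size_map size_enum_ord.
  - apply/(sortedP 0) => i; rewrite size_map size_enum_ord => Hi.
    rewrite (nth_s (Ordinal (ltnW Hi))) (nth_s (Ordinal Hi)).
    apply: subset_leq_card.
    by have /andP[] := rank_monotone HR (g_rank (Ordinal (ltnW Hi)) (Ordinal Hi) (leqnSn i)).
  - move=> i; rewrite size_map size_enum_ord => Hi.
    (* Position [i] is not below itself, so it lies outside the initial segment of length s_i. *)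
    by have := pgt_g (Ordinal Hi) (Ordinal Hi); rewrite pgt_irr /= ltnNge => /esym/negbFE.
apply/existsP; exists sg; apply/forallP => x; apply/forallP => y.
rewrite !permE ple_prefix -pgt_g /pgt (inj_eq g_inj) eq_sym.
by case: (eqVneq x y) => [->|]//=; rewrite semiorder_refl.
Qed.

(** * Isomorphism classes and the final count *)

Lemma poset_iso_refl (T : finType) (R : {set T * T}) : poset_iso R R.
Proof.
by apply/existsP; exists 1%g; apply/forallP => x; apply/forallP => y; rewrite !perm1.
Qed.

Lemma poset_iso_sym (T : finType) (R S : {set T * T}) :
  poset_iso R S -> poset_iso S R.
Proof.
case/existsP=> sg /forallP H; apply/existsP; exists (sg^-1)%g.
apply/forallP => x; apply/forallP => y.
by have /forallP/(_ (sg^-1 y)%g)/eqP <- := H (sg^-1 x)%g; rewrite !permKV.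
Qed.

Lemma poset_iso_trans (T : finType) (S R Q : {set T * T}) :
  poset_iso R S -> poset_iso S Q -> poset_iso R Q.
Proof.
case/existsP=> sg /forallP H /existsP[tau /forallP K].
apply/existsP; exists (sg * tau)%g; apply/forallP => x; apply/forallP => y.
rewrite !permM; have /forallP/(_ (sg y))/eqP -> := K (sg x).
by have /forallP/(_ y) := H x.
Qed.

Lemma poset_length_iso (T : finType) (R S : {set T * T}) :
  poset_iso R S -> poset_length R = poset_length S.
Proof.
suff le (Q Q' : {set T * T}) : poset_iso Q Q' -> poset_length Q <= poset_length Q'.
  by move=> RS; apply/eqP; rewrite eqn_leq !le // poset_iso_sym.
case/existsP=> sg /forallP H; apply/bigmax_leqP => C HC.
rewrite -(card_imset _ (@perm_inj _ sg)).
apply: (@leq_bigmax_cond _ _ (fun C : {set T} => #|C|.-1)).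
apply/forall_inP => _ /imsetP[x Cx ->]; apply/forall_inP => _ /imsetP[y Cy ->].
have /forallP/(_ y)/eqP -> := H x; have /forallP/(_ x)/eqP -> := H y.
by have /forall_inP/(_ x Cx)/forall_inP/(_ y Cy) := HC.
Qed.

Lemma parent_seq_down_sizes n (p : (2 * n).-tuple bool) :
  dyck_from 0 p -> parent_seq n (down_sizes 0 p).
Proof.
move=> Hp; split.
- by have := @size_down_sizes 0 0 p (leqnn 0) Hp; rewrite size_tuple; lia.
- exact: path_sorted (down_sizes_path 0 p).
- by move=> i Hi; have := @nth_down_sizes 0 0 p i (leqnn 0) Hp Hi.
Qed.

(** Both sides are the largest value of the depth function. For [n = 0] this fails: the empty order
    has length 0 and the one-node tree has height 0. *)
Lemma prefix_length_down_sizes n (p : (2 * n).-tuple bool) : 0 < n ->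
  dyck_from 0 p ->
  (poset_length (prefix_order n (down_sizes 0 p))).+1 =
  label_max true [:: 0] (rcons p false).
Proof.
move=> n_gt0 Hp; have Hs := parent_seq_down_sizes Hp; have [sz _ Hb] := Hs.
have [f [f0 fS]] := depth_fun_exists Hb.
rewrite (prefix_length n_gt0 Hs (conj f0 fS)).
by rewrite -(@label_max_bfs f 0 0 n p (leqnn 0) Hp sz fS) /= f0.
Qed.

(** Each word is sent to the class of its semiorder. This is onto by [semiorder_prefix] and
    injective by [prefix_order_inj]. *)
Lemma card_unlabeled_semiorders n H : 0 < n ->
  #|unlabeled_semiorders n H| = #|words_of_height true n H.+1|.
Proof.
move=> n_gt0; pose ord (p : (2 * n).-tuple bool) := prefix_order n (down_sizes 0 p).
set D := [set R : {set 'I_n * 'I_n} | is_semiorder R & poset_length R == H].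
pose cls R := [set S in D | poset_iso R S].
have ord_D p : p \in words_of_height true n H.+1 -> ord p \in D.
  rewrite !inE => /andP[Hp]; rewrite -prefix_length_down_sizes // eqSS => ->.
  by rewrite prefix_semiorder //; apply: parent_seq_down_sizes.
rewrite -[RHS](@card_in_imset _ _ (cls \o ord)).
  apply: eq_card => c; apply/imsetP/imsetP => [[R RD ->]|[p Hp ->]]; last first.
    by exists (ord p) => //; apply: ord_D.
  have /andP[HR HlR] : is_semiorder R && (poset_length R == H) by rewrite inE in RD.
  have [s Hs isoR] := semiorder_prefix HR.
  have [sz sorted_s Hb] := Hs.
  have path_s : path leq 0 s by case: (s) sorted_s.
  have [w [Hw Ew]] := down_sizes_surj (leqnn 0) path_s Hb.
  rewrite sz subnn addn0 => /eqP szw; exists (Tuple szw).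
    rewrite inE /= Hw -(@prefix_length_down_sizes _ (Tuple szw)) //= Ew eqSS.
    by rewrite (poset_length_iso isoR).
  apply/setP => S; rewrite !inE /ord /= Ew; congr (_ && _).
  apply/idP/idP; first exact: poset_iso_trans.
  by apply: poset_iso_trans; apply: poset_iso_sym.
move=> p q Hp Hq /= Epq; have : ord q \in cls (ord p).
  by rewrite Epq inE ord_D //= poset_iso_refl.
rewrite inE => /andP[_ iso_pq]; apply: val_inj.
apply: (@down_sizes_inj 0); first by rewrite !size_tuple.
move: Hp Hq; rewrite !inE => /andP[Hp _] /andP[Hq _].
by apply: prefix_order_inj iso_pq; apply: parent_seq_down_sizes.
Qed.

Theorem theorem1p1 (n H : nat) (hn : 1 <= n) :
  (ordered_trees n.+1 H.+1 #= `I_(#|unlabeled_semiorders n H|))%card /\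
  #|unlabeled_semiorders n H| = #|dyck_paths n H.+1|.
Proof.
rewrite card_unlabeled_semiorders // -words_of_height_dfs.
(* The two encodings count the same trees, which equates the two numbers of words. *)
have bfs := card_ordered_trees true n H.+1.
have dfs := card_ordered_trees false n H.+1.
split=> //; apply/card_eq_II.
by apply: card_eq_trans dfs; rewrite card_eq_sym.
Qed.
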